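(* In the setting of the context, assume that Condition UI holds: $\mathcal{Q}$ is uniformly integrable and, for every $i\in\{1,\dots,d\}$, the set $R^i\mathcal{Q} := \{R^iZ : Z\in\mathcal{Q}\}$ is uniformly integrable. Let $\overline{\mathcal{Q}}$ be the $L^1$-closure of $\mathcal{Q}$. Then the following are equivalent: (a) the market does not admit strong $\rho$-arbitrage; (b) $\overline{\mathcal{Q}}\cap\mathcal{M}\ne\emptyset$.
   Context: Let $(\Omega,\mathcal{F},\mathbb{P})$ be a probability space and a market: riskless asset $S^0_0=1$, $S^0_1=1+r$, $r>-1$; risky assets $S^1,\dots,S^d$ with constants $S^i_0>0$ and real-valued $\mathcal{F}$-measurable $S^i_1$; returns $R^i:=(S^i_1-S^i_0)/S^i_0$. Standing assumptions: nonredundancy (if $\theta\in\mathbb{R}^{1+d}$ with $\sum_{i=0}^d\theta^iS^i_t=0$ a.s. for $t\in\{0,1\}$ then $\theta=0$), $R^i\in L^1$, $\mathbb{E}[R^i]\ne r$ for some $i$. Excess return of $\pi\in\mathbb{R}^d$: $X_\pi:=\pi\cdot(R-r\mathbf{1})$. Let $L$ be a Riesz space with $L^\infty\subset L\subset L^1$ containing all $X_\pi$. $\mathcal{D}:=\{Z\in L^1: Z\ge0 \text{ a.s.}, \mathbb{E}[Z]=1\}$. $\mathcal{Q}\subset\mathcal{D}$ is convex with $1\in\mathcal{Q}$, and $\rho:L\to(-\infty,\infty]$ is given by $\rho(X)=\sup_{Z\in\mathcal{Q}}\mathbb{E}[-ZX]$, where $\mathbb{E}[-ZX]:=\mathbb{E}[ZX^-]-\mathbb{E}[ZX^+]$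 with the convention $\mathbb{E}[-ZX]=\infty$ if $\mathbb{E}[ZX^-]=\infty$. $\mathcal{M}:=\{Z\in\mathcal{D}:\mathbb{E}[Z(R^i-r)]=0 \text{ for all } i\}$. Strong $\rho$-arbitrage: for every $\pi\in\mathbb{R}^d$ there is $\pi'$ with $\mathbb{E}[X_{\pi'}]>\mathbb{E}[X_\pi]$ and $\rho(X_{\pi'})<\rho(X_\pi)$. *)

(* Defs.v *)
From HB Require Import structures.
From mathcomp Require Import all_boot all_order all_algebra.
From mathcomp Require Import all_classical all_reals all_analysis.
Set Implicit Arguments. Unset Strict Implicit. Unset Printing Implicit Defensive.
Import Order.TTheory GRing.Theory Num.Theory.
Local Open Scope classical_set_scope.
Local Open Scope ring_scope.

Section Market.
Context (dsp : measure_display) (T : measurableType dsp) (R : realType)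
        (P : probability T R) (n : nat).

Definition ret (S0 : 'I_n -> R) (S1 : 'I_n -> T -> R) (i : 'I_n) : T -> R :=
  fun w => (S1 i w - S0 i) / S0 i.

Definition excess (Rt : 'I_n -> T -> R) (r : R) (pi : 'I_n -> R) : T -> R :=
  fun w => \sum_(i < n) pi i * (Rt i w - r).

(* nonredundancy of the market (riskless asset S^0_0 = 1, S^0_1 = 1 + r) *)
Definition nonredundant (r : R) (S0 : 'I_n -> R) (S1 : 'I_n -> T -> R) : Prop :=
  forall (t0 : R) (t : 'I_n -> R),
    t0 * 1 + \sum_(i < n) t i * S0 i = 0 ->
    {ae P, forall w, t0 * (1 + r) + \sum_(i < n) t i * S1 i w = 0} ->
    t0 = 0 /\ (forall i, t i = 0).

Definition densities : set (T -> R) :=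
  [set Z | P.-integrable setT (EFin \o Z) /\ {ae P, forall w, 0 <= Z w} /\
           (\int[P]_w (Z w)%:E = 1)%E].

Definition convex_fset (Q : set (T -> R)) : Prop :=
  forall Z1 Z2 (l : R), Q Z1 -> Q Z2 -> 0 <= l <= 1 ->
    Q (fun w => l * Z1 w + (1 - l) * Z2 w).

Definition pospart (x : R) : R := Num.max x 0.
Definition negpart (x : R) : R := Num.max (- x) 0.

(* E[-ZX] := E[Z X^-] - E[Z X^+], with value +oo if E[Z X^-] = +oo *)
Definition negE (Z X : T -> R) : \bar R :=
  let a := (\int[P]_w (Z w * negpart (X w))%:E)%E in
  let b := (\int[P]_w (Z w * pospart (X w))%:E)%E in
  if a == +oo%E then +oo%E else (a - b)%E.

Definition rho (Q : set (T -> R)) (X : T -> R) : \bar R :=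
  ereal_sup [set negE Z X | Z in Q].

Definition strong_rho_arbitrage (Q : set (T -> R)) (Rt : 'I_n -> T -> R) (r : R)
  : Prop :=
  forall pi : 'I_n -> R, exists pi' : 'I_n -> R,
    (\int[P]_w (excess Rt r pi w)%:E < \int[P]_w (excess Rt r pi' w)%:E)%E /\
    (rho Q (excess Rt r pi') < rho Q (excess Rt r pi))%E.

Definition mart_densities (Rt : 'I_n -> T -> R) (r : R) : set (T -> R) :=
  [set Z | densities Z /\ forall i,
     P.-integrable setT (EFin \o (fun w => Z w * (Rt i w - r))) /\
     (\int[P]_w (Z w * (Rt i w - r))%:E = 0)%E].

Definition unif_integrable (F : set (T -> R)) : Prop :=
  (forall f, F f -> measurable_fun setT f) /\
  forall e : R, 0 < e -> exists c : R, forall f, F f ->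
    (\int[P]_(w in [set w | (c < `|f w|)%R]) (`|f w|)%:E < e%:E)%E.

Definition L1_closure (Q : set (T -> R)) : set (T -> R) :=
  [set Z | P.-integrable setT (EFin \o Z) /\
     forall e : R, 0 < e -> exists Z', Q Z' /\
       (\int[P]_w (`|Z w - Z' w|)%:E < e%:E)%E].

End Market.

(* Main.v *)
Require Import Defs.
From HB Require Import structures.
From mathcomp Require Import all_boot all_order all_algebra.
From mathcomp Require Import all_classical all_reals all_analysis.
From mathcomp Require Import measurable_realfun lra.

(** Let m(Z) be the vector of the E[Z (R^i - r)]. Uniform integrability makes m
    finite and bounded on Q, so that rho(X_pi) is the supremum of -pi.m(Z) over
    Z in Q, and m is L^1-continuous on the closure of Q. If 0 is in the closure
    of m(Q), then rho >= 0 on excess returns while rho(X_0) = 0, so nothing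
    improves on pi = 0. If not, a vector p with p.m(Z) >= d > 0 on Q gives a
    strong arbitrage, pi' = pi + p.

    It remains to see that 0 in the closure of m(Q) is attained by some Z in the
    closure of Q. Rather than weak compactness (Dunford-Pettis) and Mazur's
    lemma, one minimises a strictly convex functional, E[1/(1+Z)], approximately
    over the decreasing convex sets A_k of those Z in Q with |m(Z)|^2 <= 1/(k+1).
    The identity
      (1/u + 1/v)/2 - 2/(u+v) = (u-v)^2 / (2uv(u+v)),  u = 1 + x, v = 1 + y,
    together with uniform integrability shows that the near-minimisers form an
    L^1-Cauchy sequence; its limit has m(Z) = 0. *)

Set Implicit Arguments.
Unset Strict Implicit.
Unset Printing Implicit Defensive.
Import Order.TTheory GRing.Theory Num.Theory.
Import numFieldNormedType.Exports.
Local Open Scope classical_set_scope.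
Local Open Scope ring_scope.

(** * Integrable real functions *)

Section RealIntegral.
Context (dsp : measure_display) (T : measurableType dsp) (R : realType)
        (P : probability T R).
Implicit Types (f g : T -> R).

Local Notation L1 f := (P.-integrable setT (EFin \o f)).
Local Notation E f := (Rintegral P setT f).

Lemma L1_measurable f : L1 f -> measurable_fun setT f.
Proof. by move=> /measurable_int/measurable_EFinP. Qed.

Lemma L1_le f g : measurable_fun setT f -> L1 g ->
  (forall w, `|f w| <= g w) -> L1 f.
Proof.
move=> mf ig fg; apply: (le_integrable _ _ _ ig) => //; first exact/measurable_EFinP.
by move=> w _; rewrite /= lee_fin (le_trans (fg w))// ler_norm.
Qed.

Lemma L1_cst c : L1 (fun _ => c).
Proof. exact: finite_measure_integrable_cst. Qed.

Lemma L1_add f g : L1 f -> L1 g -> L1 (fun w => f w + g w).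
Proof. by move=> fi gi; have := integrableD measurableT fi gi. Qed.

Lemma L1_sub f g : L1 f -> L1 g -> L1 (fun w => f w - g w).
Proof. by move=> fi gi; have := integrableB measurableT fi gi. Qed.

Lemma L1_scale c f : L1 f -> L1 (fun w => c * f w).
Proof. by move=> fi; have := integrableZl measurableT c fi. Qed.

Lemma L1_norm f : L1 f -> L1 (fun w => `|f w|).
Proof. exact: integrable_norm. Qed.

Lemma L1_sum (I : finType) (F : I -> T -> R) : (forall i, L1 (F i)) ->
  L1 (fun w => \sum_i F i w).
Proof.
move=> iF.
have := @integrable_sum _ _ _ P setT measurableT I
  (index_enum I) xpredT (fun i => EFin \o F i) (fun i _ => iF i).
apply: eq_integrable => // w _ /=.
by rewrite sumEFin.
Qed.

Lemma E_cst c : E (fun _ => c) = c.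
Proof.
rewrite Rintegral_cst// -[RHS]mulr1; congr (_ * _).
transitivity (fine (P setT)); first by []. by rewrite probability_setT.
Qed.

Lemma E_add f g : L1 f -> L1 g -> E (fun w => f w + g w) = E f + E g.
Proof. exact: RintegralD. Qed.

Lemma E_sub f g : L1 f -> L1 g -> E (fun w => f w - g w) = E f - E g.
Proof. exact: RintegralB. Qed.

Lemma E_scale c f : L1 f -> E (fun w => c * f w) = c * E f.
Proof. exact: RintegralZl. Qed.

Lemma E_sum (I : finType) (F : I -> T -> R) : (forall i, L1 (F i)) ->
  E (fun w => \sum_i F i w) = \sum_i E (F i).
Proof.
move=> iF; apply: EFin_inj; rewrite -sumEFin /Rintegral fineK; last first.
  by apply: integrable_fin_num => //; exact: L1_sum.
under eq_integral do rewrite -sumEFin.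
rewrite integral_sum//; apply: eq_bigr => i _.
rewrite fineK//; apply: integrable_fin_num => //; exact: iF.
Qed.

Lemma E_EFin f : L1 f -> (\int[P]_w (f w)%:E)%E = (E f)%:E.
Proof. by move=> fi; rewrite /Rintegral fineK//; exact: integrable_fin_num. Qed.

Lemma E_le f g : L1 f -> L1 g -> (forall w, f w <= g w) -> E f <= E g.
Proof. by move=> fi gi fg; exact: le_Rintegral. Qed.

(** The minimum of [f] and [g] equals [f] almost everywhere and lies below [g] everywhere, which
    reduces the claim to the pointwise [E_le]. *)
Lemma E_le_ae f g : L1 f -> L1 g -> {ae P, forall w, f w <= g w} -> E f <= E g.
Proof.
move=> fi gi fg.
have mfi : L1 (fun w => Num.min (f w) (g w)).
  apply: (@L1_le _ (fun w => `|f w| + `|g w|)).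
  - by apply: measurable_minr; exact: L1_measurable.
  - by apply: L1_add; exact: L1_norm.
  - by move=> w; rewrite /Num.min; case: ifP => _; rewrite ?lerDl ?lerDr.
rewrite [E f](_ : _ = E (fun w => Num.min (f w) (g w))); last first.
  congr fine; apply: ae_eq_integral => //; [exact: measurable_int fi|exact: measurable_int mfi|].
  by apply: filterS fg => w fg _; rewrite /= min_l.
by apply: E_le => // w; rewrite ge_min lexx orbT.
Qed.

Lemma E_ge0 f : (forall w, 0 <= f w) -> 0 <= E f.
Proof. by move=> f0; exact: Rintegral_ge0. Qed.

Lemma E_norm f : L1 f -> `|E f| <= E (fun w => `|f w|).
Proof. by move=> fi; exact: le_normr_Rintegral. Qed.

Lemma E_sub_norm f g : L1 f -> L1 g -> `|E f - E g| <= E (fun w => `|f w - g w|).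
Proof. by move=> fi gi; rewrite -E_sub//; apply: E_norm; exact: L1_sub. Qed.

(** Monotone convergence for truncations [h N] that reach [g] at each point. Integrability of [g] is
    a conclusion: the uniform bound [e] on the truncations provides it. *)
Lemma L1_monotone_limit (g : T -> R) (h : nat -> T -> R) (e : R) :
  measurable_fun setT g ->
  (forall N w, 0 <= h N w) ->
  (forall w, nondecreasing_seq (h ^~ w)) ->
  (forall w, exists N, h N w = g w) ->
  (forall w N, h N w <= g w) ->
  (forall N, L1 (h N)) -> (forall N, E (h N) <= e) ->
  L1 g /\ E g <= e.
Proof.
move=> mg h0 ndh hg hle hi he.
have g0 w : 0 <= g w by apply: le_trans (hle w 0%N).
have cv : (\int[P]_w (h N w)%:E)%E @[N --> \oo] --> (\int[P]_w (g w)%:E)%E.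
  have -> : (\int[P]_w (g w)%:E)%E = (\int[P]_w (limn (fun N => (h N w)%:E)))%E.
    apply: eq_integral => w _; apply/esym/cvg_lim => //.
    have [N hN] := hg w; apply: cvg_near_cst; near=> M.
    have NM : (N <= M)%N by near: M; exists N.
    congr EFin; apply/eqP; rewrite eq_le hle/= -hN; exact: ndh.
  apply: (@cvg_monotone_convergence _ _ _ P setT measurableT (fun N w => (h N w)%:E)) => //.
  - by move=> N; apply/measurable_EFinP/L1_measurable.
  - by move=> N w _; rewrite lee_fin.
  - by move=> w _ m n mn; rewrite lee_fin; exact: ndh.
have le : (\int[P]_w (g w)%:E <= e%:E)%E.
  rewrite -(cvg_lim _ cv)//; apply: lime_le.
    by apply/cvg_ex; eexists; exact: cv.
  by near=> N; rewrite E_EFin// lee_fin.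
have gi : L1 g.
  apply/integrableP; split; first exact/measurable_EFinP.
  rewrite (eq_integral (fun w => (g w)%:E)).
    by apply: le_lt_trans le _; exact: ltry.
  by move=> w _; rewrite /= ger0_norm.
by split => //; rewrite -lee_fin -E_EFin.
Unshelve. all: by end_near. Qed.

End RealIntegral.

(** * Uniform integrability *)

Section UniformIntegrability.
Context (dsp : measure_display) (T : measurableType dsp) (R : realType)
        (P : probability T R).
Implicit Types (f Z : T -> R) (Q : set (T -> R)).

Local Notation L1 f := (P.-integrable setT (EFin \o f)).
Local Notation E f := (Rintegral P setT f).

(** The cut is made on the size of [Y], not of [f]. With [Y] equal to [f] this is the tail of
    uniform integrability; with [Y] a shifted return and [f] the product [Z * Y], it leaves a
    remainder on which [Y] is bounded. *)
Definition restrict_above (k : R) (Y f : T -> R) : T -> R :=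
  fun w => if k < `|Y w| then `|f w| else 0.

Lemma restrict_above_ge0 k Y f w : 0 <= restrict_above k Y f w.
Proof. by rewrite /restrict_above; case: ifP. Qed.

Lemma measurable_restrict_above k Y f :
  measurable_fun setT Y -> measurable_fun setT f ->
  measurable_fun setT (restrict_above k Y f).
Proof.
move=> mY mf; apply: measurable_fun_ifT => //; last exact: measurableT_comp.
by apply: measurable_fun_ltr => //; exact: measurableT_comp.
Qed.

Lemma L1_restrict_above k Y f : measurable_fun setT Y -> L1 f ->
  L1 (restrict_above k Y f).
Proof.
move=> mY fi; apply: (L1_le _ (L1_norm fi)).
  by apply: measurable_restrict_above => //; exact: L1_measurable fi.
move=> w; rewrite ger0_norm ?restrict_above_ge0// /restrict_above.
by case: ifP.
Qed.

(** Integrability comes from bounding [|f|] by [c] plus the tail, constants being integrable under a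
    probability. The threshold is raised to a nonnegative one for use in later estimates. *)
Lemma unif_integrable_tail (F : set (T -> R)) : unif_integrable P F ->
  forall e, 0 < e -> exists2 c, 0 <= c &
    forall f, F f -> L1 f /\ E (restrict_above c f f) < e.
Proof.
move=> [mF UI] e e0; have [c0 hc0] := UI _ e0.
exists (Num.max c0 0); first by rewrite le_max lexx orbT.
move=> f Ff; have mf := mF _ Ff; set c := Num.max c0 0.
have mr : measurable_fun setT (restrict_above c0 f f).
  exact: measurable_restrict_above.
have tail_lt : (\int[P]_w (restrict_above c0 f f w)%:E < e%:E)%E.
  apply: le_lt_trans (hc0 _ Ff); rewrite [leRHS]integral_mkcond.
  rewrite le_eqVlt; apply/orP; left; apply/eqP; apply: eq_integral => w _.
  rewrite /restrict_above patchE.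
  have -> : (w \in [set w | c0 < `|f w|]) = (c0 < `|f w|).
    by apply/idP/idP; rewrite inE.
  by case: ifP.
have ri : L1 (restrict_above c0 f f).
  apply/integrableP; split; first exact/measurable_EFinP.
  rewrite (eq_integral (fun w => (restrict_above c0 f f w)%:E)).
    by apply: lt_trans tail_lt _; exact: ltry.
  by move=> w _; rewrite /= ger0_norm// restrict_above_ge0.
have fi : L1 f.
  apply: (@L1_le _ _ _ _ _ (fun w => c + restrict_above c0 f f w)) => //.
    by apply: L1_add => //; exact: L1_cst.
  move=> w; rewrite /restrict_above; case: ltP => h.
    by rewrite lerDr le_max lexx orbT.
  by rewrite addr0 le_max h.
split => //; apply: le_lt_trans (_ : E (restrict_above c0 f f) < e); last first.
  by rewrite -lte_fin -E_EFin.
apply: E_le => //; first by apply: L1_restrict_above.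
move=> w; rewrite /restrict_above gt_max.
by case: ifPn => [/andP[-> _]//|_]; case: ifP.
Qed.

Variables (Q : set (T -> R)) (X : T -> R) (r : R).
Hypothesis UIQ : unif_integrable P Q.
Hypothesis UIX : unif_integrable P [set (fun w => X w * Z w) | Z in Q].
Hypothesis iX : L1 X.

Let Y := fun w => X w - r.

Let mY : measurable_fun setT Y.
Proof. by apply: measurable_funB => //; exact: L1_measurable iX. Qed.

Lemma L1_of_Q Z : Q Z -> L1 Z.
Proof. by move=> QZ; have [c _ /(_ _ QZ)[]] := unif_integrable_tail UIQ ltr01. Qed.

Lemma L1_moment Z : Q Z -> L1 (fun w => Z w * Y w).
Proof.
move=> QZ; have [c _ hc] := unif_integrable_tail UIX ltr01.
have [|XZ _] := hc (fun w => X w * Z w); first by exists Z.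
have := L1_sub XZ (L1_scale r (L1_of_Q QZ)).
by apply: eq_integrable => // w _ /=; rewrite /Y mulrBr [Z w * r]mulrC [Z w * _]mulrC.
Qed.

(** Uniform integrability of [X * Z] and of [Z] bounds [|Z * Y|] by two small tails plus the
    constant [b]. On the event where [|Y|] exceeds [k], Markov's inequality makes the constant cost
    at most [b / k] times the mean of [|Y|]. *)
Lemma moment_tail e : 0 < e -> exists2 k, 0 < k &
  forall Z, Q Z -> E (restrict_above k Y (fun w => Z w * Y w)) <= e.
Proof.
move=> e0.
have [c c0 hc] := unif_integrable_tail UIX (divr_gt0 e0 (ltr0n R 4)).
(* The tail of [Z] is later multiplied by [|r|]; the added 1 covers [r = 0]. *)
have r1 : 0 < 4 * (`|r| + 1) by have := normr_ge0 r; lra.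
have [c' c'0 hc'] := unif_integrable_tail UIQ (divr_gt0 e0 r1).
have iY : L1 (fun w => `|Y w|).
  by apply: L1_norm; apply: L1_sub => //; exact: L1_cst.
have EY0 : 0 <= E (fun w => `|Y w|) by apply: E_ge0.
set b := c + `|r| * c'.
have b0 : 0 <= b by rewrite addr_ge0// mulr_ge0.
(* Chosen so that the Markov term is at most [e / 4]; the added 1 keeps [k] positive when the
   product vanishes. *)
set k := 4 * b * E (fun w => `|Y w|) / e + 1.
have k0 : 0 < k by rewrite ltr_wpDl// divr_ge0 ?(ltW e0)// !mulr_ge0.
exists k => // Z QZ.
have [ZX tZX] := hc _ (ex_intro2 _ _ Z QZ erefl).
have [iZ tZ] := hc' _ QZ.
set f1 := restrict_above c _ _ in tZX.
set f2 := restrict_above c' _ _ in tZ.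
have if1 : L1 f1 by apply: L1_restrict_above => //; exact: L1_measurable ZX.
have if2 : L1 f2 by apply: L1_restrict_above => //; exact: L1_measurable iZ.
have mi := L1_moment QZ.
apply: le_trans (_ : E (fun w => f1 w + (`|r| * f2 w + b / k * `|Y w|)) <= _).
  apply: E_le; first exact: L1_restrict_above.
    by apply: L1_add => //; apply: L1_add; exact: L1_scale.
  move=> w; rewrite {1}/restrict_above; case: ifPn => [kY|_]; last first.
    have bk : 0 <= b / k by rewrite divr_ge0// ltW.
    apply: addr_ge0; first exact: restrict_above_ge0.
    by apply: addr_ge0; rewrite mulr_ge0// restrict_above_ge0.
  have h1 : `|X w * Z w| <= f1 w + c.
    by rewrite /f1 /restrict_above; case: ltP => // ?; rewrite ?lerDl ?add0r.
  have h2 : `|Z w| <= f2 w + c'.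
    by rewrite /f2 /restrict_above; case: ltP => // ?; rewrite ?lerDl ?add0r.
  have h3 : b <= b / k * `|Y w|.
    by rewrite mulrAC ler_pdivlMr// ler_wpM2l// ltW.
  have h4 : `|Z w * Y w| <= `|X w * Z w| + `|r| * `|Z w|.
    rewrite /Y mulrBr (le_trans (ler_normB _ _))// !normrM.
    by rewrite [`|Z w| * `|X w|]mulrC [`|Z w| * `|r|]mulrC.
  have h5 : `|r| * `|Z w| <= `|r| * f2 w + `|r| * c'.
    by rewrite -mulrDr ler_wpM2l.
  by rewrite /b in h3 *; lra.
rewrite E_add//; last by apply: L1_add; exact: L1_scale.
rewrite E_add ?E_scale//; try exact: L1_scale.
have g1 : `|r| * E f2 <= e / 4.
  apply: le_trans (_ : `|r| * (e / (4 * (`|r| + 1))) <= _).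
    by rewrite ler_wpM2l// ltW.
  rewrite mulrA ler_pdivrMr// mulrA divfK//; have := normr_ge0 r.
  by rewrite mulrDr mulr1 mulrC => ?; lra.
have g2 : b / k * E (fun w => `|Y w|) <= e / 4.
  rewrite mulrAC ler_pdivrMr//.
  have : k * e = 4 * b * E (fun w => `|Y w|) + e.
    by rewrite /k mulrDl mul1r divfK// gt_eqF.
  by lra.
by lra.
Qed.

End UniformIntegrability.

(** * Moments on the L^1-closure *)

Section Closure.
Context (dsp : measure_display) (T : measurableType dsp) (R : realType)
        (P : probability T R).
Implicit Types (f Z : T -> R).

Local Notation L1 f := (P.-integrable setT (EFin \o f)).
Local Notation E f := (Rintegral P setT f).

Lemma L1_closure_approx (Q : set (T -> R)) Z : (forall Z', Q Z' -> L1 Z') ->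
  L1_closure P Q Z -> forall e, 0 < e ->
  exists2 Z', Q Z' & E (fun w => `|Z w - Z' w|) < e.
Proof.
move=> QL1 [iZ Zcl] e /Zcl[Z' [QZ' lt]]; exists Z' => //.
by rewrite -lte_fin -E_EFin//; apply: L1_norm; apply: L1_sub => //; exact: QL1.
Qed.

Lemma subset_L1_closure (Q : set (T -> R)) : (forall Z', Q Z' -> L1 Z') ->
  Q `<=` L1_closure P Q.
Proof.
move=> QL1 Z QZ; split; first exact: QL1.
move=> e e0; exists Z; split => //.
under eq_integral do rewrite subrr normr0.
by rewrite integral0 lte_fin.
Qed.

(** The mean is L^1-continuous. For nonnegativity, the negative part of [Z] is at most [|Z - Z'|]
    wherever [Z'] is nonnegative, so its mean is below every positive number. *)
Lemma L1_closure_densities (Q : set (T -> R)) : Q `<=` densities P ->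
  L1_closure P Q `<=` densities P.
Proof.
move=> Qd Z clZ; have QL1 Z' : Q Z' -> L1 Z' by move=> /Qd[].
have iZ : L1 Z by case: clZ.
split => //; split; last first.
  rewrite E_EFin//; congr EFin; apply/eqP; rewrite -subr_eq0 -normr_le0.
  apply/ler_addgt0Pr => e e0; rewrite add0r.
  have [Z' QZ' lt] := L1_closure_approx QL1 clZ e0.
  have [iZ' [_ EZ']] := Qd _ QZ'.
  have EZ1 : E Z' = 1 by rewrite /Rintegral EZ'.
  by rewrite -EZ1 (le_trans (E_sub_norm iZ iZ'))// ltW.
have mn : measurable_fun setT (fun w => Num.max (- Z w) 0).
  by apply: measurable_maxr => //; apply: measurableT_comp => //; exact: L1_measurable iZ.
have n0 w : 0 <= Num.max (- Z w) 0 by rewrite le_max lexx orbT.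
have ni : L1 (fun w => Num.max (- Z w) 0).
  apply: (L1_le mn (L1_norm iZ)) => w; rewrite ger0_norm// ge_max normr_ge0 andbT.
  by rewrite -normrN ler_norm.
have neg0 : E (fun w => Num.max (- Z w) 0) = 0.
  apply/eqP; rewrite eq_le E_ge0// andbT; apply/ler_addgt0Pr => e e0; rewrite add0r.
  have [Z' QZ' lt] := L1_closure_approx QL1 clZ e0.
  have [iZ' [Z'0 _]] := Qd _ QZ'.
  apply: le_trans (ltW lt); apply: E_le_ae => //.
    by apply: L1_norm; exact: L1_sub.
  apply: filterS Z'0 => w Z'0; rewrite ge_max normr_ge0 andbT.
  by rewrite -normrN opprB (le_trans _ (ler_norm _))// lerDr.
have : ae_eq P setT (EFin \o (fun w => Num.max (- Z w) 0)) (cst 0%E).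
  apply/(ae_eq_integral_abs P measurableT); first exact/measurable_EFinP.
  under eq_integral do rewrite /= ger0_norm//.
  by rewrite E_EFin// neg0.
apply: filterS => w /(_ Logic.I)[]/= h.
by rewrite leNgt; apply/negP => Zneg; move: h; rewrite max_l; lra.
Qed.

Variables (Q : set (T -> R)) (X : T -> R) (r : R).
Hypothesis UIQ : unif_integrable P Q.
Hypothesis UIX : unif_integrable P [set (fun w => X w * Z w) | Z in Q].
Hypothesis iX : L1 X.

Let Y := fun w => X w - r.

Let mY : measurable_fun setT Y.
Proof. by apply: measurable_funB => //; exact: L1_measurable iX. Qed.

Let QL1 Z : Q Z -> L1 Z.
Proof. exact: L1_of_Q UIQ Z. Qed.

(** Integrability of [Z * Y] is not yet known on the closure. Once truncated to [|Y| < N], the tail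
    is Lipschitz in [Z] for the L^1 norm, so a nearby [Z'] in [Q] transfers the bound up to [d];
    monotone convergence in [N] then removes the truncation. *)
Lemma moment_tail_closure e : 0 < e -> exists2 k, 0 < k &
  forall Z, L1_closure P Q Z ->
    L1 (restrict_above k Y (fun w => Z w * Y w)) /\
    E (restrict_above k Y (fun w => Z w * Y w)) <= e.
Proof.
move=> e0; have [k k0 hk] := moment_tail r UIQ UIX iX e0.
exists k => // Z clZ; have iZ : L1 Z by case: clZ.
have mZY : measurable_fun setT (fun w => Z w * Y w).
  by apply: measurable_funM => //; exact: L1_measurable iZ.
set g := restrict_above _ _ _.
have g0 w : 0 <= g w by exact: restrict_above_ge0.
have mg : measurable_fun setT g by exact: measurable_restrict_above.
pose h (N : nat) w := if `|Y w| < N%:R then g w else 0.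
have h0 N w : 0 <= h N w by rewrite /h; case: ifP.
have hg N w : h N w <= g w by rewrite /h; case: ifP.
have mh N : measurable_fun setT (h N).
  apply: measurable_fun_ifT => //.
  by apply: measurable_fun_ltr => //; exact: measurableT_comp.
have hN N w : h N w <= N%:R * `|Z w|.
  rewrite /h; case: ifPn => [YN|_]; last by rewrite mulr_ge0.
  rewrite /g /restrict_above; case: ifPn => _; last by rewrite mulr_ge0.
  by rewrite normrM mulrC ler_wpM2r// ltW.
have ih N : L1 (h N).
  apply: (L1_le (mh N) (L1_scale N%:R (L1_norm iZ))) => w.
  by rewrite ger0_norm.
apply: (@L1_monotone_limit _ _ _ P g h) => //.
- move=> w m n mn; rewrite /h; case: ifPn => [Ym|_].
    by rewrite (lt_le_trans Ym)// ler_nat.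
  by case: ifP.
- move=> w; exists (Num.truncn `|Y w|).+1; rewrite /h.
  by rewrite truncnS_gt.
move=> N; apply/ler_addgt0Pr => d d0.
(* [N] may be 0, hence the shifted Lipschitz constant by which [d] is divided. *)
have N1 : 0 < N%:R + 1 :> R by rewrite ltr_wpDl.
have [Z' QZ' lt] := L1_closure_approx QL1 clZ (divr_gt0 d0 N1).
have iD : L1 (fun w => `|Z w - Z' w|).
  by apply: L1_norm; apply: L1_sub => //; exact: QL1.
have iR : L1 (restrict_above k Y (fun w => Z' w * Y w)).
  by apply: L1_restrict_above => //; exact: (L1_moment r UIQ UIX).
apply: le_trans (_ : E (fun w => restrict_above k Y (fun w => Z' w * Y w) w +
   (N%:R + 1) * `|Z w - Z' w|) <= _).
  apply: E_le => //; first by apply: L1_add => //; exact: L1_scale.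
  move=> w; rewrite /h /g /restrict_above.
  have D0 : 0 <= (N%:R + 1) * `|Z w - Z' w| by rewrite mulr_ge0// ltW.
  case: ifPn => [YN|_]; case: ifPn => [kY|_]; rewrite ?add0r ?addr_ge0//.
  rewrite !normrM.
  have a : `|Z w| <= `|Z' w| + `|Z w - Z' w|.
    by rewrite -{1}[Z w](subrK (Z' w)) addrC ler_normD.
  have b : `|Z w - Z' w| * `|Y w| <= (N%:R + 1) * `|Z w - Z' w|.
    by rewrite mulrC ler_wpM2r//; lra.
  apply: le_trans (_ : (`|Z' w| + `|Z w - Z' w|) * `|Y w| <= _).
    by rewrite ler_wpM2r.
  by rewrite mulrDl lerD2l.
rewrite E_add ?E_scale//; last exact: L1_scale.
apply: lerD; first exact: hk.
by rewrite mulrC -ler_pdivlMr// ltW.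
Qed.

Lemma L1_moment_closure Z : L1_closure P Q Z -> L1 (fun w => Z w * Y w).
Proof.
move=> clZ; have [k k0 /(_ _ clZ)[it _]] := moment_tail_closure ltr01.
have iZ : L1 Z by case: clZ.
apply: (@L1_le _ _ _ _ _
    (fun w => k * `|Z w| + restrict_above k Y (fun w => Z w * Y w) w)).
- by apply: measurable_funM => //; exact: L1_measurable iZ.
- by apply: L1_add => //; apply: L1_scale; exact: L1_norm.
move=> w; rewrite /restrict_above; case: ltP => h.
  by rewrite lerDr mulr_ge0// ltW.
by rewrite addr0 normrM mulrC ler_wpM2r.
Qed.

(** Where [|Y| <= k] the difference is at most [k * |Z - Z'|]; elsewhere the two uniform tails bound
    it. Each of the three terms contributes at most [e / 3]. *)
Lemma moment_continuous e : 0 < e -> exists2 d, 0 < d &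
  forall Z Z', L1_closure P Q Z -> L1_closure P Q Z' ->
    E (fun w => `|Z w - Z' w|) < d ->
    `|E (fun w => Z w * Y w) - E (fun w => Z' w * Y w)| <= e.
Proof.
move=> e0; have e3 : 0 < e / 3 by rewrite divr_gt0.
have [k k0 hk] := moment_tail_closure e3.
exists (e / 3 / k); first by rewrite divr_gt0.
move=> Z Z' clZ clZ' lt.
have [iZ iZ'] : L1 Z /\ L1 Z' by case: clZ => ? _; case: clZ'.
have [t1 l1] := hk _ clZ; have [t2 l2] := hk _ clZ'.
have m1 := L1_moment_closure clZ; have m2 := L1_moment_closure clZ'.
have iD : L1 (fun w => `|Z w - Z' w|) by apply: L1_norm; exact: L1_sub.
apply: le_trans (E_sub_norm m1 m2) _.
set f1 := restrict_above _ _ _ in t1 l1; set f2 := restrict_above _ _ _ in t2 l2.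
apply: le_trans (_ : E (fun w => k * `|Z w - Z' w| + (f1 w + f2 w)) <= _).
  apply: E_le; [by apply: L1_norm; exact: L1_sub| |].
    by apply: L1_add; [exact: L1_scale|exact: L1_add].
  move=> w; rewrite /f1 /f2 /restrict_above; case: ltP => h.
    rewrite (le_trans (ler_normB _ _))// lerDr mulr_ge0//; exact: ltW.
  by rewrite !addr0 -mulrBl normrM mulrC ler_wpM2r.
rewrite E_add; [|exact: L1_scale|exact: L1_add].
rewrite E_scale// E_add//.
have : k * E (fun w => `|Z w - Z' w|) <= e / 3.
  by rewrite mulrC -ler_pdivlMr// ltW.
by lra.
Qed.

End Closure.

(** * Completeness of L^1 *)

Section Completeness.
Context (dsp : measure_display) (T : measurableType dsp) (R : realType)
        (P : probability T R).

Local Notation L1 f := (P.-integrable setT (EFin \o f)).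
Local Notation E f := (Rintegral P setT f).

Lemma cvg_of_summable_increments (u : nat -> R) (M : R) :
  (forall n, \sum_(0 <= j < n) `|u j.+1 - u j| <= M) -> cvgn u.
Proof.
move=> uM.
have /normed_cvg ct : cvgn [normed series (telescope u)].
  apply: nondecreasing_is_cvgn.
    by apply: nondecreasing_series => i _ _; exact: normr_ge0.
  by exists M => _ [n _ <-] /=; exact: uM.
rewrite (_ : u = (fun n => u 0%N + series (telescope u) n)).
  by apply: is_cvgD => //; exact: is_cvg_cst.
by apply/funext => n; exact: eq_sum_telescope.
Qed.

(** Dominated convergence, with [|h 0|] plus the sum of all absolute increments as dominating
    function; the geometric bounds make that sum integrable. *)
Lemma L1_cvg_of_summable_increments (h : nat -> T -> R) :
  (forall k, L1 (h k)) ->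
  (forall k, E (fun w => `|h k.+1 w - h k w|) <= 1 / (2 ^ k.+1)%:R) ->
  exists2 Z, L1 Z & E (fun w => `|h k w - Z w|) @[k --> \oo] --> 0.
Proof.
move=> ih hh.
have iD k : L1 (fun w => `|h k.+1 w - h k w|) by apply: L1_norm; exact: L1_sub.
have mD k : measurable_fun setT (fun w => (`|h k.+1 w - h k w|)%:E).
  by apply/measurable_EFinP; exact: L1_measurable (iD k).
pose G w := (\sum_(0 <= k <oo) (`|h k.+1 w - h k w|)%:E)%E.
have G0 w : (0 <= G w)%E by apply: nneseries_ge0 => k _ _; rewrite lee_fin.
have mG : measurable_fun setT G.
  by apply: ge0_emeasurable_sum => // k w _ _; rewrite lee_fin.
have iG : P.-integrable setT G.
  apply/integrableP; split => //.
  under eq_integral do rewrite gee0_abs//.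
  rewrite /G integral_nneseries//.
  apply: (@le_lt_trans _ _ (1%:E)%E); last exact: ltry.
  apply: le_trans (@epsilon_trick0 R 1 xpredT ler01).
  apply: lee_nneseries => k _; last by rewrite E_EFin// lee_fin; exact: hh.
  by move=> _; rewrite E_EFin// lee_fin E_ge0.
have partial w n : (\sum_(0 <= k < n) (`|h k.+1 w - h k w|)%:E <= G w)%E.
  by apply: nneseries_lim_ge => k _ _; rewrite lee_fin.
(* The upper limit is defined and measurable everywhere; it is the true limit wherever [G] is
   finite, hence almost everywhere. *)
pose Z w := fine (limn_esup (fun k => (h k w)%:E)).
have mZ : measurable_fun setT Z.
  apply: measurableT_comp => //.
  apply: measurable_fun_limn_esup => k.
  by apply/measurable_EFinP; exact: L1_measurable (ih k).
have cvZ : {ae P, forall w, setT w -> (h k w)%:E @[k --> \oo] --> (Z w)%:E}.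
  apply: filterS (integrable_ae measurableT iG) => w /(_ Logic.I) Gfin _.
  have /cvg_ex[l hl] : cvgn (h ^~ w).
    apply: (@cvg_of_summable_increments _ (fine (G w))) => n.
    by rewrite -lee_fin fineK// -sumEFin; exact: partial.
  have hl' : (h k w)%:E @[k --> \oo] --> l%:E.
    by apply/fine_cvgP; split => //; exact: nearW.
  by rewrite /Z (cvg_limn_einf_sup hl').2.
have iB : P.-integrable setT (fun w => (`|h 0%N w|)%:E + G w)%E.
  by apply: integrableD => //; exact: L1_norm.
have bound : {ae P, forall w k, setT w ->
    (`|(h k w)%:E| <= (`|h 0%N w|)%:E + G w)%E}.
  apply: aeW => w k _; apply: le_trans (leeD2l _ (partial w k)).
  rewrite sumEFin /= -EFinD lee_fin.
  rewrite {1}(eq_sum_telescope (h ^~ w) k) (le_trans (ler_normD _ _))// lerD2l.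
  by rewrite /series /=; exact: ler_norm_sum.
have mh k : measurable_fun setT (EFin \o h k) by exact: measurable_int (ih k).
have mZE : measurable_fun setT (EFin \o Z) by exact/measurable_EFinP.
have [iZ cv _] :=
  dominated_convergence measurableT mh mZE cvZ iB bound.
exists Z => //.
have -> : (fun k => E (fun w => `|h k w - Z w|)) =
    fine \o (fun k => \int[P]_w (`|(h k w)%:E - (Z w)%:E|))%E.
  by apply/funext => k.
exact: fine_cvg cv.
Qed.

Lemma L1_complete (f : nat -> T -> R) : (forall k, L1 (f k)) ->
  (forall e, 0 < e -> exists N, forall i j, (N <= i)%N -> (N <= j)%N ->
     E (fun w => `|f i w - f j w|) < e) ->
  exists2 Z, L1 Z & forall e, 0 < e -> exists N, forall k, (N <= k)%N ->
    E (fun w => `|Z w - f k w|) < e.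
Proof.
move=> fi cauchy.
have half_gt0 k : 0 < 1 / (2 ^ k.+1)%:R :> R by rewrite divr_gt0// ltr0n expn_gt0.
have /choice[N hN] k := cauchy _ (half_gt0 k).
(* Summing the successors makes [s] strictly increasing and at least both [N k] and [k], although
   [N] itself need not be monotone. *)
pose s k := (\sum_(i < k.+1) (N i).+1)%N.
have sS k : s k.+1 = (s k + (N k.+1).+1)%N by rewrite /s big_ord_recr.
have sN k : (N k <= s k)%N.
  by rewrite /s big_ord_recr /= -ltnS ltnW// !ltnS leq_addl.
have sk k : (k <= s k)%N.
  elim: k => // k ih; rewrite sS; apply: leq_ltn_trans ih _.
  by rewrite -addn1 leq_add2l.
have [|k|Z iZ cv] := @L1_cvg_of_summable_increments (fun k => f (s k)).
- by move=> k; exact: fi.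
- apply/ltW/hN => //; rewrite sS; apply: leq_trans (sN k) _; exact: leq_addr.
exists Z => // e e0; have e2 : 0 < e / 2 by rewrite divr_gt0.
have [M hM] := cauchy _ e2.
exists M => k Mk.
have [K _ hK] : \forall k \near \oo, E (fun w => `|f (s k) w - Z w|) < e / 2.
  exact: cvgr_lt cv _ e2.
pose m := maxn K M.
have := hK m (leq_maxl _ _) => /= h1.
have h2 := hM (s m) k (leq_trans (leq_maxr K M) (sk m)) Mk.
have i1 : L1 (fun w => `|f (s m) w - Z w|) by apply: L1_norm; exact: L1_sub.
have i2 : L1 (fun w => `|f (s m) w - f k w|) by apply: L1_norm; exact: L1_sub.
apply: le_lt_trans (_ : E (fun w => `|f (s m) w - Z w| + `|f (s m) w - f k w|) < e).
  apply: E_le; [by apply: L1_norm; exact: L1_sub|exact: L1_add|].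
  move=> w; rewrite -[`|f (s m) w - Z w|]normrN opprB.
  by apply: le_trans (ler_normD _ _); rewrite addrA subrK.
by rewrite E_add//; lra.
Qed.

End Completeness.

(** * L^1-limits from nested convex sets *)

Section NearMinimisers.
Context (dsp : measure_display) (T : measurableType dsp) (R : realType)
        (P : probability T R).
Implicit Types (Z : T -> R).

Local Notation L1 f := (P.-integrable setT (EFin \o f)).
Local Notation E f := (Rintegral P setT f).

(** Densities are nonnegative only almost everywhere. The absolute value keeps the function
    continuous with values in [0,1] on the whole line; convexity holds, and is exploited, on the
    nonnegative half-line. *)
Definition bounded_convex (x : R) : R := (1 + `|x|)^-1.
Local Notation phi := bounded_convex.

Lemma bounded_convex_ge0 x : 0 <= phi x.
Proof. by rewrite invr_ge0 addr_ge0. Qed.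

Lemma bounded_convex_le1 x : phi x <= 1.
Proof. by rewrite invf_le1 ?lerDl// ltr_wpDr. Qed.

Lemma midpoint_gap (x y : R) : 0 <= x -> 0 <= y ->
  (phi x + phi y) / 2 - phi (2^-1 * x + 2^-1 * y) =
  (x - y) ^+ 2 / (2 * (1 + x) * (1 + y) * (2 + x + y)).
Proof.
move=> x0 y0; rewrite /phi !ger0_norm//; last first.
  by rewrite addr_ge0// mulr_ge0.
have -> : 1 + (2^-1 * x + 2^-1 * y) = (2 + x + y) / 2 by lra.
rewrite invf_div.
have u0 : 1 + x != 0 by rewrite gt_eqF// ltr_wpDr.
have v0 : 1 + y != 0 by rewrite gt_eqF// ltr_wpDr.
have s0 : 2 + x + y != 0 by rewrite gt_eqF//; lra.
have uv0 : 2 * (1 + x) * (1 + y) * (2 + x + y) != 0 by rewrite !mulf_neq0.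
apply/(canRL (mulfK uv0)).
have eu := mulVf u0; have ev := mulVf v0; have es := mulVf s0.
set a := (1 + x)^-1 in eu *; set b := (1 + y)^-1 in ev *.
set c := (2 + x + y)^-1 in es *.
(* Pairing each inverse with its own denominator lets [eu], [ev], [es] turn the rational identity
   into a polynomial one. *)
transitivity ((a * (1 + x)) * ((1 + y) * (2 + x + y))
  + (b * (1 + y)) * ((1 + x) * (2 + x + y))
  - 4 * (c * (2 + x + y)) * ((1 + x) * (1 + y))).
  by lra.
by rewrite eu ev es; lra.
Qed.

(** If both points are at most [c], the denominator of the gap is at most [4 * (1 + c) ^+ 3], and
    [t <= eta + t ^+ 2 / eta] turns the squared distance into a distance. Otherwise the points above
    [c] already dominate the distance. *)
Lemma dist_le_midpoint_gap (c eta x y : R) : 0 <= c -> 0 < eta ->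
  0 <= x -> 0 <= y ->
  `|x - y| <= eta + 4 * (1 + c) ^+ 3 / eta *
      ((phi x + phi y) / 2 - phi (2^-1 * x + 2^-1 * y)) +
    ((if c < `|x| then `|x| else 0) + (if c < `|y| then `|y| else 0)).
Proof.
move=> c0 eta0 x0 y0; rewrite midpoint_gap// [`|x|]ger0_norm// [`|y|]ger0_norm//.
set den := 2 * _ * _ * _.
have den0 : 0 < den by rewrite /den !mulr_gt0//; lra.
have t0 : 0 <= 4 * (1 + c) ^+ 3 / eta * ((x - y) ^+ 2 / den).
  rewrite mulr_ge0// divr_ge0 ?sqr_ge0 ?(ltW den0)// ?(ltW eta0)//.
  by rewrite mulr_ge0// exprn_ge0// addr_ge0.
have [cx|xc] := ltP c x; have [cy|yc] := ltP c y.
- by have : `|x - y| <= x + y by [rewrite ler_norml; lra]; lra.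
- by have : `|x - y| <= x by [rewrite ler_norml; lra]; lra.
- by have : `|x - y| <= y by [rewrite ler_norml; lra]; lra.
have den_le : den <= 4 * (1 + c) ^+ 3.
  rewrite /den (_ : 4 * (1 + c) ^+ 3 = 2 * (1 + c) * (1 + c) * (2 + c + c)).
    by rewrite !ler_pM ?mulr_ge0//; lra.
  by lra.
have sq : (x - y) ^+ 2 / eta <= 4 * (1 + c) ^+ 3 / eta * ((x - y) ^+ 2 / den).
  rewrite [leRHS]mulrAC ler_wpM2r ?invr_ge0 ?(ltW eta0)//.
  by rewrite mulrA ler_pdivlMr// mulrC ler_wpM2r ?sqr_ge0.
have amgm : `|x - y| <= eta + (x - y) ^+ 2 / eta.
  rewrite -(ler_pM2r eta0) mulrDl divfK ?gt_eqF//.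
  rewrite -real_normK ?num_real//; have := sqr_ge0 (`|x - y| - eta).
  have := normr_ge0 (x - y); set t := `|x - y| => tp.
  by have := mulr_ge0 tp (ltW eta0); lra.
by lra.
Qed.

Lemma L1_bounded_convex Z : measurable_fun setT Z -> L1 (fun w => phi (Z w)).
Proof.
move=> mZ; apply: (L1_le _ (L1_cst P 1)).
  apply: (measurableT_comp _ mZ); apply: continuous_measurable_fun => x.
  apply: cvgV; first by rewrite gt_eqF// ltr_wpDr.
  by apply: cvgD; [exact: cvg_cst|exact: norm_continuous].
by move=> w; rewrite ger0_norm ?bounded_convex_ge0// bounded_convex_le1.
Qed.

(* Replaces the weak compactness of uniformly integrable sets. *)
Lemma L1_limit_of_nested_convex (Q : set (T -> R)) (A : nat -> set (T -> R)) :
  unif_integrable P Q -> (forall Z, Q Z -> {ae P, forall w, 0 <= Z w}) ->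
  (forall k, A k `<=` Q) -> (forall k, A k !=set0) ->
  (forall j k, (j <= k)%N -> A k `<=` A j) ->
  (forall k Z Z', A k Z -> A k Z' -> A k (fun w => 2^-1 * Z w + 2^-1 * Z' w)) ->
  exists2 Z, L1 Z & forall e k, 0 < e ->
    exists2 Z', A k Z' & E (fun w => `|Z w - Z' w|) < e.
Proof.
move=> UIQ Q0 AQ An Adec Aconv.
have QL1 Z : Q Z -> L1 Z by exact: L1_of_Q.
pose J Z := E (fun w => phi (Z w)).
have iphi Z : Q Z -> L1 (fun w => phi (Z w)).
  by move=> /QL1 iZ; apply: L1_bounded_convex; exact: L1_measurable iZ.
have J0 Z : 0 <= J Z by apply: E_ge0 => w; exact: bounded_convex_ge0.
have J1 Z : Q Z -> J Z <= 1.
  move=> QZ; rewrite -(E_cst P 1); apply: E_le; [exact: iphi|exact: L1_cst|].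
  by move=> w; exact: bounded_convex_le1.
pose V k := [set J Z | Z in A k].
have Vlb k : has_lbound (V k) by exists 0 => _ [Z _ <-].
have Vinf k : has_inf (V k).
  by split => //; have [Z AZ] := An k; exists (J Z), Z.
(* As the sets [A k] shrink their infima increase, and they stay below 1, so their supremum is
   finite. *)
pose a k := inf (V k).
have asup : has_sup (range a).
  split; first by exists (a 0%N), 0%N.
  exists 1 => _ [k _ <-]; have [Z AZ] := An k.
  apply: le_trans (J1 _ (AQ _ _ AZ)); apply: ge_inf => //.
  by exists Z.
have /choice[f hf] k : exists Z, A k Z /\ J Z < a k + k.+1%:R^-1.
  have [|_ [Z AZ <-] lt] := @inf_adherent _ (V k) k.+1%:R^-1 _ (Vinf k).
    by rewrite invr_gt0 ltr0n.
  by exists Z.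
have fQ k : Q (f k) by apply: AQ; exact: (hf k).1.
have [|e e0|Z iZ cv] := @L1_complete _ _ _ P f; last first.
- exists Z => // e k e0; have [N hN] := cv e e0.
  exists (f (maxn k N)); last exact: hN (leq_maxr _ _).
  by apply: (Adec k (maxn k N)); [exact: leq_maxl|exact: (hf _).1].
- have e4 : 0 < e / 4 by rewrite divr_gt0.
  have [c c0 hc] := unif_integrable_tail UIQ e4.
  set C := 4 * (1 + c) ^+ 3 / (e / 4).
  have C0 : 0 < C by rewrite divr_gt0// mulr_gt0// exprn_gt0// ltr_wpDr.
  (* The gap will have mean at most [2 * d], costing [e / 8] after multiplication by [C]. With
     [eta = e / 4] and two tails below [e / 4], the total stays under [e]. *)
  pose d := e / 16 / C.
  have d0 : 0 < d by rewrite divr_gt0// divr_gt0.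
  (* For late indices both near-minimisers lie in [A N] with [J] at most the supremum plus [d].
     Their midpoint is also in [A N], so its [J] exceeds the supremum minus [d]; this bounds the
     mean gap by [2 * d]. *)
  have [_ [N _ <-] aN] := sup_adherent d0 asup.
  have [M hM] : exists M : nat, M.+1%:R^-1 < d.
    by exists (Num.truncn d^-1); rewrite invf_plt ?posrE ?ltr0n// truncnS_gt.
  have near_min j : (maxn N M <= j)%N -> A N (f j) /\ J (f j) <= sup (range a) + d.
    rewrite geq_max => /andP[Nj Mj]; have [Aj Jj] := hf j; split.
      exact: Adec Aj.
    apply: le_trans (ltW Jj) _; apply: lerD.
      by apply: ub_le_sup; [exact: asup.2|exists j].
    by apply: le_trans (ltW hM); rewrite lef_pV2 ?posrE ?ltr0n// ler_nat ltnS.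
  exists (maxn N M) => i j /near_min[Ai Ji] /near_min[Aj Jj].
  have [Qi Qj] := (fQ i, fQ j).
  have Am := Aconv _ _ _ Ai Aj; set m := (fun w => _) in Am.
  have Jm : a N <= J m by apply: ge_inf => //; exists m.
  have [ip jp] := (iphi _ Qi, iphi _ Qj); have mp := iphi _ (AQ _ _ Am).
  have [ii ti] := hc _ Qi; have [ij tj] := hc _ Qj.
  set f1 := restrict_above _ _ _ in ti; set f2 := restrict_above _ _ _ in tj.
  have i1 : L1 f1 by apply: L1_restrict_above => //; exact: L1_measurable ii.
  have i2 : L1 f2 by apply: L1_restrict_above => //; exact: L1_measurable ij.
  pose D w := 2^-1 * (phi (f i w) + phi (f j w)) - phi (m w).
  have iD : L1 D by apply: L1_sub => //; apply: L1_scale; exact: L1_add.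
  have ED : E D <= 2 * d.
    rewrite E_sub//; last by apply: L1_scale; exact: L1_add.
    rewrite E_scale; last exact: L1_add.
    rewrite E_add//; rewrite -/(J (f i)) -/(J (f j)) -/(J m).
    by move: (J (f i)) (J (f j)) (J m) (a N) Ji Jj Jm aN => *; lra.
  apply: le_lt_trans (_ : E (fun w => e / 4 + C * D w + (f1 w + f2 w)) < e).
    apply: E_le_ae; first by apply: L1_norm; exact: L1_sub.
      apply: L1_add; last exact: L1_add.
      by apply: L1_add; [exact: L1_cst|exact: L1_scale].
    apply: filterS2 (Q0 _ Qi) (Q0 _ Qj) => w fi0 fj0.
    rewrite /D [2^-1 * _]mulrC; exact: dist_le_midpoint_gap.
  rewrite E_add; last 2 first.
  - by apply: L1_add; [exact: L1_cst|exact: L1_scale].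
  - exact: L1_add.
  rewrite E_add//; rewrite (@E_add _ _ _ P (fun=> e / 4)); [|exact: L1_cst|exact: L1_scale].
  rewrite E_cst E_scale//.
  have : C * E D <= e / 8.
    have Cd : C * d = e / 16 by rewrite mulrC divfK// gt_eqF.
    rewrite (le_trans (ler_wpM2l (ltW C0) ED))// mulrCA Cd; lra.
  by lra.
by move=> k; exact: QL1.
Qed.

End NearMinimisers.

(** * Separation in finite dimension *)

Section Separation.
Context (R : realType) (n : nat).
Implicit Types (x y p : 'I_n -> R) (K : set ('I_n -> R)).

Definition dot x y := \sum_i x i * y i.

Lemma dot_ge0 x : 0 <= dot x x.
Proof. by apply: sumr_ge0 => i _; rewrite -expr2 sqr_ge0. Qed.

Lemma dot_convex_combination (l : R) x p :
  let z := fun i => l * x i + (1 - l) * p i in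
  dot z z = l ^+ 2 * dot x x + 2 * l * (1 - l) * dot p x
            + (1 - l) ^+ 2 * dot p p.
Proof.
rewrite /dot !mulr_sumr -!big_split /=; apply: eq_bigr => i _.
by lra.
Qed.

(* A point of almost minimal norm is a normal vector, so no projection onto the
   closure of K is needed. *)
Lemma separation_from_0 K (B e : R) : K !=set0 ->
  (forall x y l, K x -> K y -> 0 <= l <= 1 ->
     K (fun i => l * x i + (1 - l) * y i)) ->
  (forall x, K x -> dot x x <= B) ->
  0 < e -> (forall x, K x -> e <= dot x x) ->
  exists p, exists2 d, 0 < d & forall x, K x -> d <= dot p x.
Proof.
move=> [x0 Kx0] Kconv KB e0 Ke.
pose V := [set dot x x | x in K].
have Vinf : has_inf V.
  by split; [exists (dot x0 x0), x0|exists e => _ [x Kx <-]; exact: Ke].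
set s := inf V.
have s0 : 0 < s.
  apply: (lt_le_trans e0); apply: lb_le_inf; first exact: Vinf.1.
  by move=> _ [x Kx <-]; exact: Ke.
have sle x : K x -> s <= dot x x.
  by move=> Kx; apply: ge_inf; [exact: Vinf.2|exists x].
have B0 : 0 <= B by apply: le_trans (KB _ Kx0); exact: dot_ge0.
(* The weight of [x] in the combination with [p]: small enough that [l <= 1/4] and that the
   quadratic term in [x] is at most [l * s / 4]. *)
pose l := s / (4 * (B + s)).
have q0 : 0 < 4 * (B + s) by lra.
have l0 : 0 < l by rewrite divr_gt0.
have lq : l * (4 * (B + s)) = s by rewrite divfK// gt_eqF.
have l4 : l <= 4^-1.
  by rewrite ler_pdivrMr//; lra.
have lB : l * B <= s / 4.
  have := mulr_gt0 l0 s0; lra.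
have ls0 : 0 < l * s / 4 by rewrite divr_gt0// mulr_gt0.
(* The excess of [dot p p] over the infimum must be of order [l], so that it does not swamp the
   cross term, which is linear in [l]. *)
have [_ [p Kp <-] ps] := inf_adherent ls0 Vinf.
exists p, (s / 2); first by rewrite divr_gt0.
move=> x Kx.
have l01 : 0 <= l <= 1 by lra.
have := sle _ (Kconv _ _ _ Kx Kp l01).
rewrite dot_convex_combination => h.
have h1 : l ^+ 2 * dot x x <= l * (s / 4).
  rewrite expr2 -mulrA ler_wpM2l ?(ltW l0)//.
  by apply: le_trans lB; rewrite ler_wpM2l ?(ltW l0)// KB.
have h2 : (1 - l) ^+ 2 * dot p p <= (1 - l) ^+ 2 * s + l * s / 4.
  apply: le_trans (_ : (1 - l) ^+ 2 * (s + l * s / 4) <= _).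
    by rewrite ler_wpM2l ?sqr_ge0// ltW.
  rewrite mulrDr lerD2l ler_piMl ?(ltW ls0)//.
  by rewrite expr_le1//; lra.
have h3 : l * s <= l * (2 * (1 - l) * dot p x).
  have : l ^+ 2 * s <= l * s / 4.
    by have := ler_wpM2l (ltW (mulr_gt0 l0 s0)) l4; lra.
  by lra.
move: h3; rewrite ler_pM2l// => h3.
rewrite leNgt; apply/negP => h4.
have [pos|neg] := leP 0 (dot p x).
  have := mulr_ge0 (ltW l0) pos; lra.
have := mulr_ge0 (_ : 0 <= 1 - l) (_ : 0 <= - dot p x); lra.
Qed.

End Separation.

(** * Strong arbitrage and martingale densities *)

Section Market.
Context (dsp : measure_display) (T : measurableType dsp) (R : realType)
        (P : probability T R) (n : nat).
Implicit Types (Z : T -> R) (pi : 'I_n -> R).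

Local Notation L1 f := (P.-integrable setT (EFin \o f)).
Local Notation E f := (Rintegral P setT f).

(** Integrability of the product makes both halves finite, so the convention for infinite values
    never applies. *)
Lemma negE_EFin Z X : measurable_fun setT Z -> measurable_fun setT X ->
  L1 (fun w => Z w * X w) -> negE P Z X = (- E (fun w => Z w * X w))%:E.
Proof.
move=> mZ mX iZX.
have part (u : R -> R) : measurable_fun setT u -> (forall x, `|u x| <= `|x|) ->
    L1 (fun w => Z w * u (X w)).
  move=> mu hu; apply: (L1_le _ (L1_norm iZX)).
    by apply: measurable_funM => //; exact: measurableT_comp.
  by move=> w; rewrite !normrM ler_wpM2l.
have i1 : L1 (fun w => Z w * negpart (X w)).
  apply: part; first by apply: measurable_maxr => //; exact: measurableT_comp.
  move=> x; rewrite /negpart ger0_norm ?le_max ?lexx ?orbT//.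
  by rewrite ge_max normr_ge0 andbT -normrN ler_norm.
have i2 : L1 (fun w => Z w * pospart (X w)).
  apply: part; first exact: measurable_maxr.
  move=> x; rewrite /pospart ger0_norm ?le_max ?lexx ?orbT//.
  by rewrite ge_max normr_ge0 andbT ler_norm.
rewrite /negE !E_EFin//= -EFinB -E_sub// -mulN1r -E_scale//; congr EFin.
congr (Rintegral P setT); apply/funext => w.
rewrite -mulrBr mulN1r -mulrN; congr (_ * _); rewrite /negpart /pospart /Num.max.
by case: ltP => ?; case: ltP => ?; lra.
Qed.

Variables (Q : set (T -> R)) (Rt : 'I_n -> T -> R) (r : R).
Hypothesis iRt : forall i, L1 (Rt i).
Hypothesis UIQ : unif_integrable P Q.
Hypothesis UIR : forall i, unif_integrable P [set (fun w => Rt i w * Z w) | Z in Q].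

Definition moment Z (i : 'I_n) : R := E (fun w => Z w * (Rt i w - r)).

Let QL1 Z : Q Z -> L1 Z.
Proof. exact: L1_of_Q UIQ Z. Qed.

Let iY i : L1 (fun w => Rt i w - r).
Proof. by apply: L1_sub => //; exact: L1_cst. Qed.

Let mom_L1 Z i : Q Z -> L1 (fun w => Z w * (Rt i w - r)).
Proof. by move=> QZ; exact: (L1_moment r UIQ (UIR i) QZ). Qed.

(** The expected excess return is the pairing with the moment of the density 1, which belongs to
    [Q]. A single separating vector thus controls both expectation and risk. *)
Lemma E_excess pi : E (excess Rt r pi) = dot pi (moment (fun=> 1)).
Proof.
rewrite /excess E_sum; last by move=> i; exact: L1_scale.
apply: eq_bigr => i _; rewrite E_scale//; congr (_ * E _).
by apply/funext => w; rewrite mul1r.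
Qed.

Lemma L1_excess pi : L1 (excess Rt r pi).
Proof. by apply: L1_sum => i; exact: L1_scale. Qed.

Lemma negE_excess Z pi : Q Z ->
  negE P Z (excess Rt r pi) = (- dot pi (moment Z))%:E.
Proof.
move=> QZ.
have eZ : (fun w => Z w * excess Rt r pi w) =
    (fun w => \sum_i pi i * (Z w * (Rt i w - r))).
  by apply/funext => w; rewrite mulr_sumr; apply: eq_bigr => i _; rewrite mulrCA.
have iS i : L1 (fun w => pi i * (Z w * (Rt i w - r))).
  by apply: L1_scale; exact: mom_L1.
rewrite negE_EFin ?eZ.
- rewrite E_sum//; congr (- _)%:E; apply: eq_bigr => i _.
  by rewrite E_scale//; exact: mom_L1.
- exact: L1_measurable (QL1 QZ).
- exact: L1_measurable (L1_excess pi).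
- exact: L1_sum.
Qed.

Lemma rho_excess_ge Z pi : Q Z ->
  ((- dot pi (moment Z))%:E <= rho P Q (excess Rt r pi))%E.
Proof. by move=> QZ; apply: ereal_sup_ubound; exists Z => //; exact: negE_excess. Qed.

Lemma rho_excess_le pi c : (forall Z, Q Z -> - dot pi (moment Z) <= c) ->
  (rho P Q (excess Rt r pi) <= c%:E)%E.
Proof.
move=> h; apply: ge_ereal_sup => _ [Z QZ <-].
by rewrite negE_excess// lee_fin h.
Qed.

(** The part where [|Y| <= k] contributes at most [k] times the mean of [|Z|], itself at most
    [c + 1]; the tail adds at most 1. The bound serves both the separation argument and the
    finiteness of [rho]. *)
Lemma moment_bounded : exists B, forall Z i, Q Z -> `|moment Z i| <= B.
Proof.
have bnd i : exists B, forall Z, Q Z -> `|moment Z i| <= B.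
  have [k k0 hk] := moment_tail r UIQ (UIR i) (iRt i) ltr01.
  have [c c0 hc] := unif_integrable_tail UIQ ltr01.
  exists (k * (c + 1) + 1) => Z QZ; have iZ := QL1 QZ.
  set Y := (fun w => Rt i w - r) in hk.
  have mY : measurable_fun setT Y by exact: L1_measurable (iY i).
  apply: le_trans (E_norm (mom_L1 i QZ)) _.
  set f := restrict_above k Y (fun w => Z w * Y w).
  have fi : L1 f by apply: L1_restrict_above => //; exact: mom_L1.
  have gi : L1 (restrict_above c Z Z).
    by apply: L1_restrict_above => //; exact: L1_measurable iZ.
  have hi : L1 (fun w => k * (c + restrict_above c Z Z w)).
    by apply: L1_scale; apply: L1_add => //; exact: L1_cst.
  apply: le_trans (_ : E (fun w => k * (c + restrict_above c Z Z w) + f w) <= _).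
    apply: E_le; [by apply: L1_norm; exact: mom_L1|exact: L1_add|].
    have Zc w : `|Z w| <= c + restrict_above c Z Z w.
      by rewrite /restrict_above; case: ltP => h; rewrite ?lerDr ?addr0.
    move=> w; have Zc0 := le_trans (normr_ge0 _) (Zc w).
    rewrite /f {2}/restrict_above; case: ltP => h.
      by rewrite lerDr mulr_ge0// ltW.
    by rewrite addr0 normrM mulrC ler_pM.
  rewrite E_add// E_scale; last by apply: L1_add => //; exact: L1_cst.
  rewrite E_add//; last exact: L1_cst.
  rewrite E_cst; apply: lerD; last exact: hk.
  by rewrite ler_wpM2l ?(ltW k0)// lerD2l ltW//; exact: (hc _ QZ).2.
have /choice[B hB] := bnd.
exists (\sum_i `|B i|) => Z i QZ; apply: le_trans (hB i Z QZ) _.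
by rewrite (bigD1 i)//= (le_trans (ler_norm _))// lerDl sumr_ge0.
Qed.

Hypothesis Qd : Q `<=` densities P.
Hypothesis Qconv : convex_fset Q.
Hypothesis Q1 : Q (fun=> 1).

Lemma moment_convex Z Z' (l : R) : Q Z -> Q Z' ->
  moment (fun w => l * Z w + (1 - l) * Z' w) =
  (fun i => l * moment Z i + (1 - l) * moment Z' i).
Proof.
move=> QZ QZ'; apply/funext => i; rewrite /moment.
rewrite -E_scale; last exact: mom_L1.
rewrite -E_scale; last exact: mom_L1.
rewrite -E_add; [|by apply: L1_scale; exact: mom_L1..].
by congr (E _); apply/funext => w; rewrite mulrDl !mulrA.
Qed.

(** Adding the separating vector [p] to any portfolio raises the expectation and lowers [rho], each
    by at least [d]. *)
Lemma strong_arbitrage_of_far_moments e : 0 < e ->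
  (forall Z, Q Z -> e <= dot (moment Z) (moment Z)) ->
  strong_rho_arbitrage P Q Rt r.
Proof.
move=> e0 far; have [B hB] := moment_bounded.
have [||||p [d d0 hd]] := @separation_from_0 R n [set moment Z | Z in Q]
    (\sum_(i < n) B ^+ 2) e _ _ _ e0 _.
- by exists (moment (fun=> 1)), (fun=> 1).
- move=> _ _ l [Z QZ <-] [Z' QZ' <-] l01; rewrite -moment_convex//.
  by eexists; [exact: Qconv QZ QZ' l01|].
- move=> _ [Z QZ <-]; apply: ler_sum => i _; rewrite -expr2 -real_normK ?num_real//.
  by rewrite lerXn2r ?nnegrE ?hB// (le_trans (normr_ge0 (moment Z i)))// hB.
- by move=> _ [Z QZ <-]; exact: far.
move=> pi; exists (fun i => pi i + p i).
have dotD Z : dot (fun i => pi i + p i) (moment Z) = dot pi (moment Z) + dot p (moment Z).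
  by rewrite /dot -big_split; apply: eq_bigr => i _; rewrite mulrDl.
have pd Z : Q Z -> d <= dot p (moment Z) by move=> QZ; apply: hd; exists Z.
rewrite !E_EFin; [|exact: L1_excess..].
rewrite !E_excess lte_fin dotD; split; first by rewrite ltrDl (lt_le_trans d0)// pd.
(* Finiteness is essential: subtracting [d] gives a strict decrease only from a finite value. *)
have rho_fin : rho P Q (excess Rt r pi) \is a fin_num.
  rewrite fin_numE; apply/andP; split.
    by rewrite gt_eqF// (lt_le_trans (ltNyr _) (rho_excess_ge pi Q1)).
  rewrite lt_eqF//; apply: (le_lt_trans _ (ltry (\sum_i `|pi i| * B))).
  apply: rho_excess_le => Z QZ; rewrite /dot -sumrN; apply: ler_sum => i _.
  rewrite (le_trans (ler_norm _))// normrN normrM ler_wpM2l//; exact: hB.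
move: rho_fin (fun Z => @rho_excess_ge Z pi).
case: (rho P Q (excess Rt r pi)) => // s _ hs.
apply: (@le_lt_trans _ _ (s - d)%:E); last by rewrite lte_fin ltrBlDr ltrDl.
apply: rho_excess_le => Z QZ; rewrite dotD opprD lerB ?pd//.
by rewrite -lee_fin; exact: hs.
Qed.

Lemma martingale_density_of_near_moments :
  (forall e, 0 < e -> exists2 Z, Q Z & dot (moment Z) (moment Z) < e) ->
  (L1_closure P Q `&` mart_densities P Rt r) !=set0.
Proof.
move=> near0.
(* Convexity of the squared norm makes each set stable under midpoints. *)
pose A k := [set Z | Q Z /\ dot (moment Z) (moment Z) <= k.+1%:R^-1].
have half01 : 0 <= (2^-1 : R) <= 1 by lra.
have half : 1 - 2^-1 = 2^-1 :> R by lra.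
have [| | |j k jk Z [QZ mZ]|k Z Z' [QZ mZ] [QZ' mZ']|Z iZ hZ] :=
    @L1_limit_of_nested_convex _ _ _ P Q A UIQ.
- by move=> Z /Qd[_ []].
- by move=> k Z [].
- move=> k; have [|Z QZ lt] := near0 k.+1%:R^-1; first by rewrite invr_gt0 ltr0n.
  by exists Z; split => //; exact: ltW.
- by split => //; apply: (le_trans mZ); rewrite lef_pV2 ?posrE ?ltr0n// ler_nat ltnS.
- have := Qconv QZ QZ' half01; have := moment_convex 2^-1 QZ QZ'; rewrite half.
  move=> eqm Qm; split => //; rewrite eqm.
  apply: (@le_trans _ _ (2^-1 * dot (moment Z) (moment Z) +
                         2^-1 * dot (moment Z') (moment Z'))); last first.
    by move: (k.+1%:R^-1) mZ mZ' => /= c mZ mZ'; lra.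
  rewrite /dot !mulr_sumr -big_split /=; apply: ler_sum => i _.
  by have := sqr_ge0 (moment Z i - moment Z' i); lra.
have clZ : L1_closure P Q Z.
  split => // e e0; have [Z' [QZ' _] lt] := hZ e 0%N e0.
  exists Z'; split => //; rewrite E_EFin ?lte_fin//.
  by apply: L1_norm; apply: L1_sub => //; exact: QL1.
exists Z; split => //; split; first exact: L1_closure_densities clZ.
move=> i; have iZY := L1_moment_closure r UIQ (UIR i) (iRt i) clZ.
split => //; rewrite E_EFin//; congr EFin; apply/eqP; rewrite -normr_le0.
apply/ler_addgt0Pr => e e0; rewrite add0r.
have e2 : 0 < e / 2 by rewrite divr_gt0.
have [d d0 hd] := moment_continuous r UIQ (UIR i) (iRt i) e2.
(* The squared norm of the moment is then below [(e / 2) ^+ 2], so each coordinate is at most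
   [e / 2]; continuity accounts for the other half. *)
have [k hk] : exists k : nat, k.+1%:R^-1 < (e / 2) ^+ 2.
  exists (Num.truncn ((e / 2) ^+ 2)^-1).
  by rewrite invf_plt ?posrE ?ltr0n ?exprn_gt0// truncnS_gt.
have [Z' [QZ' mZ'] lt] := hZ d k d0.
have close := hd _ _ clZ (subset_L1_closure QL1 QZ') lt.
have small : `|moment Z' i| <= e / 2.
  rewrite -(@ler_pXn2r _ 2)// ?nnegrE ?(ltW e2)// real_normK ?num_real//.
  apply: le_trans (ltW hk); apply: le_trans mZ'.
  by rewrite /dot (bigD1 i)//= -expr2 lerDl sumr_ge0// => j _; rewrite -expr2 sqr_ge0.
rewrite -[X in `|X|](subrK (moment Z' i)) (le_trans (ler_normD _ _))//.
by rewrite [leRHS](_ : _ = e / 2 + e / 2) ?lerD//; lra.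
Qed.

(** The zero portfolio cannot be improved: its risk is at most 0. The density [Z] may lie outside
    [Q], so elements of [Q] near it, with moments close to 0, show that every other risk is at least
    [- e]. *)
Lemma no_arbitrage_of_martingale_density :
  (L1_closure P Q `&` mart_densities P Rt r) !=set0 ->
  ~ strong_rho_arbitrage P Q Rt r.
Proof.
move=> [Z [clZ [_ mart]]] /(_ (fun=> 0))[pi' [_]].
have mZ i : moment Z i = 0 by rewrite /moment /Rintegral (mart i).2.
have rho0 : (rho P Q (excess Rt r (fun=> 0%R)) <= (0 : R)%:E)%E.
  apply: rho_excess_le => Z' _; rewrite oppr_le0 sumr_ge0// => i _.
  by rewrite mul0r.
move=> /lt_le_trans/(_ rho0); apply/negP; rewrite -leNgt.
set m := rho _ _ _; apply/lee_addgt0Pr => e e0.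
pose M := \sum_i `|pi' i| + 1.
have M0 : 0 < M by rewrite ltr_wpDl// sumr_ge0.
have /choice[d hd] i : exists d, 0 < d /\ forall Z', Q Z' ->
    E (fun w => `|Z w - Z' w|) < d -> `|moment Z' i| <= e / M.
  have [d d0 hd] := moment_continuous r UIQ (UIR i) (iRt i) (divr_gt0 e0 M0).
  exists d; split => // Z' QZ' lt.
  have := hd _ _ clZ (subset_L1_closure QL1 QZ') lt.
  by rewrite -/(moment Z i) mZ sub0r normrN.
(* One radius for all assets; the default 1 keeps it positive even with no risky asset. *)
pose d0 := \big[Num.min/1]_i d i.
have d0_gt0 : 0 < d0.
  by apply: (big_ind (fun x : R => 0 < x)) => [//|x y x0 y0|i _];
    [rewrite lt_min x0|exact: (hd i).1].
have [Z' QZ' lt] := L1_closure_approx QL1 clZ d0_gt0.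
have small i : `|moment Z' i| <= e / M.
  have lti : E (fun w => `|Z w - Z' w|) < d i.
    by apply: lt_le_trans lt _; exact: bigmin_le_cond.
  exact: ((hd i).2 _ QZ' lti).
apply: le_trans (leeD2r _ (rho_excess_ge pi' QZ')).
rewrite -EFinD lee_fin addrC subr_ge0.
apply: (@le_trans _ _ (\sum_i `|pi' i| * (e / M))).
  apply: ler_sum => i _; rewrite (le_trans (ler_norm _))// normrM.
  by rewrite ler_wpM2l.
rewrite -mulr_suml mulrCA ler_piMr ?(ltW e0)// ler_pdivrMr// mul1r.
by rewrite lerDl.
Qed.

Theorem no_strong_arbitrage_iff :
  ~ strong_rho_arbitrage P Q Rt r <->
  (L1_closure P Q `&` mart_densities P Rt r) !=set0.
Proof.
split; last exact: no_arbitrage_of_martingale_density.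
move=> noarb; apply: martingale_density_of_near_moments => e e0.
apply: contrapT => far; apply: noarb; apply: (@strong_arbitrage_of_far_moments e) => //.
by move=> Z QZ; rewrite leNgt; apply/negP => lt; apply: far; exists Z.
Qed.

End Market.

Theorem theorem4p15 (dsp : measure_display) (T : measurableType dsp)
  (R : realType) (P : probability T R) (n : nat) (r : R)
  (S0 : 'I_n -> R) (S1 : 'I_n -> T -> R) (Q : set (T -> R)) :
  -1 < r ->
  (forall i, 0 < S0 i) ->
  (forall i, measurable_fun setT (S1 i)) ->
  nonredundant P r S0 S1 ->
  (forall i, P.-integrable setT (EFin \o ret S0 S1 i)) ->
  (exists i, (\int[P]_w (ret S0 S1 i w)%:E != r%:E)%E) ->
  Q `<=` densities P ->
  convex_fset Q ->
  Q (fun _ => 1) ->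
  (* Condition UI *)
  unif_integrable P Q ->
  (forall i, unif_integrable P [set (fun w => ret S0 S1 i w * Z w) | Z in Q]) ->
  (~ strong_rho_arbitrage P Q (ret S0 S1) r <->
   (L1_closure P Q `&` mart_densities P (ret S0 S1) r) !=set0).
Proof.
move=> _ _ _ _ iR _ Qd Qconv Q1 UIQ UIR.
exact: no_strong_arbitrage_iff.
Qed.
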